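(* Let $(X,\triangleright)=(G,S,\{H_s\})$ be a rack such that $S\subseteq G$ normally generates $G$. Let $X_s=G/H_s$, $s\in S$, be a connected component of $(X,\triangleright)$. Then the rack metric $d_s$ on $X_s$ is equivalent to the quotient metric $d_S$ on $G/H_s$; that is, there is a constant $C\ge1$ such that $C^{-1}d_S(p,q)\le d_s(p,q)\le C\,d_S(p,q)$ for all $p,q\in G/H_s$.
   Context: A rack is a non-empty set $X$ with a binary operation $\triangleright$ such that for every $x\in X$ the map $\psi_x(y)=x\triangleright y$ is a bijection of $X$, and $x\triangleright(y\triangleright z)=(x\triangleright y)\triangleright(x\triangleright z)$ for all $x,y,z$. The connected components of $X$ are the orbits of the group generated by all $\psi_x$. The rack metric on a connected component is $d(x,y)=\min\{n\in\mathbb N\mid y=(\psi_{x_1}^{\pm1}\circ\dots\circ\psi_{x_n}^{\pm1})(x)\text{ for some }x_i\in X\}$ ($n=0$ allowed). Let $G$ be a group, $S\subseteq G$ a subset and $\{H_s\le G\mid s\in S\}$ a family of subgroups with $H_s\le Z(s)$, where $Z(s)$ is the centraliser of $s$ in $G$. The rack $(G,S,\{H_s\})$ is the set $X=\bigsqcup_{s\in S}G/H_s$ with operation $xH_s\triangleright yH_t=xsx^{-1}yH_t$. $S$ normally generates $G$ if the set of all conjugates of elements of $S$ generates $G$. In that case $\|g\|_S$ denotes the minimal $n\in\mathbb N$ such that $g$ is a product of $n$ conjugates of elements of $S\cup S^{-1}$ (a conjugation-invariant norm), with associated bi-invariant metric $d_S(g,h)=\|g^{-1}h\|_S$ on $G$.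 For a subgroup $H\le G$ the quotient metric on $G/H$ is $d_S(xH,yH)=\min\{\|x^{-1}yh\|_S\mid h\in H\}$. *)

(* Defs.v *)
From HB Require Import structures.
From mathcomp Require Import all_boot all_order all_algebra.
From mathcomp Require Import boolp classical_sets reals.

Set Implicit Arguments.
Unset Strict Implicit.
Unset Printing Implicit Defensive.

Local Open Scope classical_set_scope.

(* [nat_min set0 = 0] is a junk value; see [nat_minP] for nonempty sets. *)
Definition nat_min (A : set nat) : nat :=
  xget 0 [set n | A n /\ forall m, A m -> (n <= m)%N].

Lemma nat_minP (A : set nat) : A !=set0 ->
  A (nat_min A) /\ forall m, A m -> (nat_min A <= m)%N.
Proof.
move=> [k Ak]; rewrite /nat_min.
have ex : exists n, `[< A n >] by exists k; apply/asboolP.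
apply: (@xgetPex _ 0 [set n | A n /\ forall m, A m -> (n <= m)%N]).
case: (ex_minnP ex) => n /asboolP An nmin.
by exists n; split=> // m Am; apply: nmin; apply/asboolP.
Qed.

Record rack := Rack {
  rack_sort :> Type;
  rack_op : rack_sort -> rack_sort -> rack_sort;
  rack_inhabited : inhabited rack_sort;
  rack_bij : forall x, bijective (rack_op x);
  rack_distr : forall x y z,
    rack_op x (rack_op y z) = rack_op (rack_op x y) (rack_op x z) }.

Section RackMetric.
Variable X : rack.
Implicit Types (x y z : X) (e : bool) (f g : X -> X).

Definition psi x : X -> X := rack_op x.

Lemma psi_inv_ex x : {g : X -> X | cancel (psi x) g & cancel g (psi x)}.
Proof. by apply: cid2; case: (rack_bij x) => g gK Kg; exists g. Qed.

Definition psi_inv x : X -> X := s2val (psi_inv_ex x).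

Lemma psiK x : cancel (psi x) (psi_inv x).
Proof. exact: s2valP (psi_inv_ex x). Qed.

Lemma psi_invK x : cancel (psi_inv x) (psi x).
Proof. exact: s2valP' (psi_inv_ex x). Qed.

Definition psi_pm e x : X -> X := if e then psi x else psi_inv x.

(* The group generated by all [psi x], inside the bijections of [X]. *)
Inductive inner : (X -> X) -> Prop :=
| inner_id : inner id
| inner_psi x : inner (psi x)
| inner_comp f g : inner f -> inner g -> inner (f \o g)
| inner_inv f g : cancel f g -> cancel g f -> inner f -> inner g.

Definition connected_component (A : set X) : Prop :=
  exists x, A = [set f x | f in inner].

(* [(psi_(x_1)^e_1 \o ... \o psi_(x_n)^e_n) x] for
   [w = [:: (e_1, x_1); ...; (e_n, x_n)]] *)
Definition psi_word (w : seq (bool * X)) x : X :=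
  foldr (fun u z => psi_pm u.1 u.2 z) x w.

(* Meaningful only for [x] and [y] in the same connected component. *)
Definition rack_dist x y : nat :=
  nat_min [set size w | w in [set w | y = psi_word w x]].

End RackMetric.

Local Open Scope group_scope.

Section Group.
Variable G : groupType.

Definition conjugates (A : set G) : set G := [set a ^ g | a in A & g in setT].

(* Classically, boolean predicates on [G] are arbitrary subsets, so [K] ranges
   over all subgroups of [G]. *)
Definition normally_generates (S : set G) : Prop :=
  forall K : groupClosed G, (forall x, conjugates S x -> x \in K) ->
  forall x, x \in K.

(* Meaningful on all of [G] only if [S] normally generates [G]. *)
Definition conj_norm (S : set G) (g : G) : nat :=
  nat_min [set size w | w in [set w : seq G |
    (forall a, a \in w -> conjugates (S `|` [set t^-1 | t in S]) a) /\
    g = \prod_(a <- w) a]].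

Section Cosets.
Variable H : groupClosed G.

Definition lcoset_rel (x y : G) : bool := x^-1 * y \in H.

Lemma lcoset_rel_equiv : equiv_class_of lcoset_rel.
Proof.
split=> [x|x y|y x z]; rewrite /lcoset_rel.
- by rewrite mulVg gpred1.
- by rewrite -gpredV invgM invgK.
- by move=> xy yz; have := gpredM _ _ xy yz; rewrite mulgA mulgK.
Qed.

Canonical lcoset_equiv := EquivRelPack lcoset_rel_equiv.

Definition lcosets : Type := {eq_quot lcoset_equiv}%qT.
HB.instance Definition _ := Choice.on lcosets.
HB.instance Definition _ := EqQuotient.on lcosets.

Definition lcoset (x : G) : lcosets := \pi_lcosets%qT x.

Lemma lcosetP x y : lcoset x = lcoset y <-> x^-1 * y \in H.
Proof. by split=> [/eqmodP|xy]; last exact/eqmodP. Qed.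

Lemma lcoset_repr (p : lcosets) : lcoset (repr p) = p.
Proof. exact: reprK. Qed.

(* See [quot_dist_lcoset] for independence of the representatives. *)
Definition quot_dist (S : set G) (p q : lcosets) : nat :=
  nat_min [set conj_norm S ((repr p)^-1 * repr q * h) | h in [set h | h \in H]].

End Cosets.

Section CosetRack.
Variables (S : set G) (H : S -> groupClosed G).

Definition coset_rack_sort : Type := {s : S & lcosets (H s)}.

(* See [coset_rack_opE] for independence of the representatives. *)
Definition coset_rack_op (p q : coset_rack_sort) : coset_rack_sort :=
  let x := repr (tagged p) in
  Tagged (fun t => lcosets (H t))
    (lcoset (H (tag q)) (x * val (tag p) * x^-1 * repr (tagged q))).

Definition coset_rack_pt (s : S) (p : lcosets (H s)) : coset_rack_sort :=
  Tagged (fun t => lcosets (H t)) p.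

Hypothesis S_neq0 : S !=set0.
Hypothesis H_central : forall s : S, {in H s, forall h, commute h (val s)}.

Lemma coset_rack_opE (s t : S) (x y : G) :
  coset_rack_op (coset_rack_pt (lcoset (H s) x)) (coset_rack_pt (lcoset (H t) y))
  = coset_rack_pt (lcoset (H t) (x * val s * x^-1 * y)).
Proof.
rewrite /coset_rack_op /coset_rack_pt /=; congr (Tagged _ _).
have /lcosetP xx' := lcoset_repr (lcoset (H s) x).
have /lcosetP yy' := lcoset_repr (lcoset (H t) y).
set x' := repr _ in xx' *; set y' := repr _ in yy' *.
have -> : x' * val s * x'^-1 = x * val s * x^-1.
  have -> : x = x' * (x'^-1 * x) by rewrite mulgA mulgV mul1g.
  move: (x'^-1 * x) (H_central xx') => k c.
  by rewrite invgM -(mulgA x' k) c !mulgA mulgK.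
have shift c : lcoset (H t) (c * y') = lcoset (H t) (c * y).
  by apply/lcosetP; rewrite invgM !mulgA mulgVK.
exact: shift.
Qed.

Lemma coset_rack_ptP (p : coset_rack_sort) :
  exists s x, p = coset_rack_pt (lcoset (H s) x).
Proof. by case: p => s p; exists s, (repr p); rewrite lcoset_repr. Qed.

Lemma coset_rack_inhabited : inhabited coset_rack_sort.
Proof.
case: S_neq0 => s /mem_set Ss.
exact: inhabits (coset_rack_pt (lcoset (H (exist _ s Ss)) 1)).
Qed.

Definition coset_shift (g : G) (p : coset_rack_sort) : coset_rack_sort :=
  coset_rack_pt (lcoset (H (tag p)) (g * repr (tagged p))).

Lemma coset_shiftE g s x : coset_shift g (coset_rack_pt (lcoset (H s) x)) =
  coset_rack_pt (lcoset (H s) (g * x)).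
Proof.
rewrite /coset_shift /=; congr (Tagged _ _); apply/lcosetP.
have /lcosetP xx' := lcoset_repr (lcoset (H s) x).
by rewrite invgM !mulgA mulgVK.
Qed.

Lemma coset_shift1 : coset_shift 1 =1 id.
Proof.
by move=> p; have [s [x ->]] := coset_rack_ptP p; rewrite coset_shiftE mul1g.
Qed.

Lemma coset_shiftM g h : coset_shift (g * h) =1 coset_shift g \o coset_shift h.
Proof.
by move=> p; have [s [x ->]] := coset_rack_ptP p; rewrite /= !coset_shiftE mulgA.
Qed.

Lemma coset_rack_op_shift s x : coset_rack_op (coset_rack_pt (lcoset (H s) x))
  =1 coset_shift (x * val s * x^-1).
Proof.
move=> p; have [t [y ->]] := coset_rack_ptP p.
by rewrite coset_rack_opE coset_shiftE.
Qed.

Lemma coset_shiftK g : cancel (coset_shift g) (coset_shift g^-1).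
Proof. by move=> p; have /= <- := coset_shiftM g^-1 g p; rewrite mulVg coset_shift1. Qed.

Lemma coset_shiftVK g : cancel (coset_shift g^-1) (coset_shift g).
Proof. by move=> p; have := coset_shiftK g^-1 p; rewrite invgK. Qed.

Lemma coset_rack_bij p : bijective (coset_rack_op p).
Proof.
have [s [x ->]] := coset_rack_ptP p.
rewrite (funext (coset_rack_op_shift s x)).
by exists (coset_shift (x * val s * x^-1)^-1);
  [apply: coset_shiftK | apply: coset_shiftVK].
Qed.

Lemma coset_rack_distr p q r : coset_rack_op p (coset_rack_op q r) =
  coset_rack_op (coset_rack_op p q) (coset_rack_op p r).
Proof.
have [s [x ->]] := coset_rack_ptP p; have [t [y ->]] := coset_rack_ptP q.
have [u [z ->]] := coset_rack_ptP r.
rewrite !coset_rack_opE; congr (coset_rack_pt (lcoset (H u) _)).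
move: (val s) (val t) => {}s {}t.
by rewrite !invgM !invgK !mulgA !mulgVK mulgK.
Qed.

Definition coset_rack : rack :=
  Rack coset_rack_inhabited coset_rack_bij coset_rack_distr.

Definition coset_part (s : S) : set coset_rack :=
  [set coset_rack_pt p | p in [set: lcosets (H s)]].

(* Normal generation makes every [coset_part s] a connected component, so that
   [rack_dist] is a minimum over a nonempty set there. *)
Lemma coset_part_component (s : S) :
  normally_generates S -> connected_component (coset_part s).
Proof.
move=> genS.
pose P : {pred G} := fun g => `[< @inner coset_rack (coset_shift g) >].
have P1 : 1 \in P.
  by apply/asboolP; rewrite (funext coset_shift1); apply: inner_id.
have PM : {in P &, forall x y, x * y \in P}.
  move=> g h /asboolP Pg /asboolP Ph; apply/asboolP.
  by rewrite (funext (coset_shiftM g h)); apply: (@inner_comp coset_rack).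
have PV : {in P, forall x, x^-1 \in P}.
  move=> g /asboolP Pg; apply/asboolP.
  exact: (@inner_inv coset_rack _ _ (coset_shiftK g) (coset_shiftVK g)).
pose PH := isMulClosed.Build G P PM.
pose P1H := isMul1Closed.Build G P P1.
pose PVH := isInvClosed.Build G P PV.
pose K : groupClosed G := HB.pack P PH P1H PVH.
have inK g : @inner coset_rack (coset_shift g).
  apply/asboolP; apply: (genS K) => _ [t St [k _ <-]]; apply/asboolP.
  pose t' : S := exist _ t (mem_set St).
  have := @inner_psi coset_rack (coset_rack_pt (lcoset (H t') k^-1)).
  by rewrite /psi /= (funext (coset_rack_op_shift _ _)) /= invgK /conjg mulgA.
exists (coset_rack_pt (lcoset (H s) 1)); apply/seteqP; split=> [_ [p _ <-]|].
  exists (coset_shift (repr p)) => //.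
  by rewrite coset_shiftE mulg1 lcoset_repr.
have pt q : tag q = s -> coset_part s q.
  by case: q => t p /= ts; case: _ / ts p => p; exists p.
move=> _ [f fP <-]; apply: pt.
suff: forall q, tag (f q) = tag q by move->.
elim: fP => [//|//|f1 f2 _ IH1 _ IH2 q /=|f1 f2 _ fK _ IH q].
  by rewrite IH1 IH2.
by rewrite -IH fK.
Qed.

End CosetRack.

Lemma conj_normJ S g k : conj_norm S (g ^ k) = conj_norm S g.
Proof.
have conjgsK a j : conjugates (S `|` [set t^-1 | t in S]) a ->
    conjugates (S `|` [set t^-1 | t in S]) (a ^ j).
  by move=> [t tS [l _ <-]]; exists t => //; exists (l * j); rewrite ?conjgM.
have sub x j : [set size w | w in [set w : seq G |
    (forall a, a \in w -> conjugates (S `|` [set t^-1 | t in S]) a) /\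
    x = \prod_(a <- w) a]] `<=` [set size w | w in [set w : seq G |
    (forall a, a \in w -> conjugates (S `|` [set t^-1 | t in S]) a) /\
    x ^ j = \prod_(a <- w) a]].
  move=> _ [w [wS ->] <-]; exists [seq a ^ j | a <- w]; last by rewrite size_map.
  split=> [_ /mapP[a /wS aS ->]|]; first exact: conjgsK.
  rewrite big_map; elim: w {wS} => [|a w IHw]; first by rewrite !big_nil conj1g.
  by rewrite !big_cons conjMg IHw.
rewrite /conj_norm; congr nat_min; apply/seteqP; split; last exact: sub.
by have := sub (g ^ k) k^-1; rewrite conjgK.
Qed.

Lemma quot_dist_lcoset (H : groupClosed G) S x y :
  quot_dist S (lcoset H x) (lcoset H y) =
  nat_min [set conj_norm S (x^-1 * y * h) | h in [set h | h \in H]].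
Proof.
rewrite /quot_dist; congr nat_min.
have /lcosetP xx' := lcoset_repr (lcoset H x).
have /lcosetP yy' := lcoset_repr (lcoset H y).
set x' := repr _ in xx' *; set y' := repr _ in yy' *.
have sub a a' b b' : a'^-1 * a \in H -> b'^-1 * b \in H ->
    [set conj_norm S (a'^-1 * b' * h) | h in [set h | h \in H]] `<=`
    [set conj_norm S (a^-1 * b * h) | h in [set h | h \in H]].
  move=> aa' bb' _ [h /= hH <-].
  exists ((b'^-1 * b)^-1 * h * (a'^-1 * a)).
    by apply: gpredM => //; apply: gpredM => //; rewrite gpredV.
  rewrite -(conj_normJ S (a'^-1 * b' * h) (a'^-1 * a)) /conjg.
  by congr (conj_norm S _); rewrite !invgM !invgK !mulgA !mulgK.
apply/seteqP; split; apply: sub => //.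
- by rewrite -gpredV invgM invgK.
- by rewrite -gpredV invgM invgK.
Qed.

End Group.

Arguments coset_part {G S H} S_neq0 H_central s.
Arguments rack_dist : clear implicits.

(* Main.v *)
(** The rack metric and the quotient metric in fact coincide. Each map [psi_p]
    of the coset rack is the left translation by a conjugate of an element of
    [S], and every such translation arises in this way. Hence a word of length
    [n] from [xH] to [yH] in the rack is a product [g] of [n] conjugates of
    elements of [S] and their inverses with [g x H = y H]; conjugating by [x],
    this is a factorization of [x^-1 y h] into [n] such conjugates for some
    [h] in [H]. *)
From HB Require Import structures.
Require Import Defs.
From mathcomp Require Import all_boot all_order all_algebra.
From mathcomp Require Import boolp classical_sets reals.

Local Open Scope classical_set_scope.

(** Serves to merge the minimum over [H] in the quotient metric with the minimum over words in the
    norm. An empty [A i] would contribute the default value 0 of [nat_min] on the left and nothing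
    on the right. *)
Lemma nat_min_bigcup (I : Type) (D : set I) (A : I -> set nat) :
  D !=set0 -> (forall i, D i -> A i !=set0) ->
  nat_min [set nat_min (A i) | i in D] = nat_min (\bigcup_(i in D) A i).
Proof.
move=> [i0 Di0] A0.
have [|[i Di <-] min_i] := @nat_minP [set nat_min (A i) | i in D].
  by exists (nat_min (A i0)), i0.
have [|[j Dj Aj] min_j] := @nat_minP (\bigcup_(i in D) A i).
  by have [n An] := A0 _ Di0; exists n, i0.
apply/eqP; rewrite eqn_leq; apply/andP; split.
  apply: leq_trans (min_i _ (ex_intro2 _ _ j Dj erefl)) _.
  by have [_] := nat_minP (A0 _ Dj); apply.
by apply: min_j; exists i => //; have [] := nat_minP (A0 _ Di).
Qed.

Local Open Scope group_scope.

Section ConjWords.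
Set Implicit Arguments.
Unset Strict Implicit.
Variables (G : groupType) (S : set G).

Definition signed_conjugates : set G := conjugates (S `|` [set t^-1 | t in S]).

(** The set whose [nat_min] is by definition [conj_norm S g]. Working with all lengths rather than
    the least one postpones minima to the very end. *)
Definition conj_lengths (g : G) : set nat :=
  [set size w | w in [set w : seq G |
    (forall a, a \in w -> signed_conjugates a) /\ g = \prod_(a <- w) a]].

Lemma signed_conjugatesJ a j : signed_conjugates a -> signed_conjugates (a ^ j).
Proof. by move=> [t tS [l _ <-]]; exists t => //; exists (l * j); rewrite ?conjgM. Qed.

Lemma signed_conjugatesV a : signed_conjugates a -> signed_conjugates a^-1.
Proof.
move=> [t tS [l _ <-]]; exists t^-1; last by exists l; rewrite ?conjVg.
case: tS => [St|[u Su <-]]; last by left; rewrite invgK.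
by right; exists t.
Qed.

Lemma conj_lengths1 : conj_lengths 1 0%N.
Proof. by exists [::] => //; split; rewrite ?big_nil. Qed.

Lemma conj_lengths_gen a : signed_conjugates a -> conj_lengths a 1%N.
Proof.
move=> Sa; exists [:: a] => //=; split; last by rewrite big_seq1.
by move=> b; rewrite inE => /eqP->.
Qed.

Lemma conj_lengthsM g h m n :
  conj_lengths g m -> conj_lengths h n -> conj_lengths (g * h) (m + n).
Proof.
move=> [v [vS ->] <-] [w [wS ->] <-]; exists (v ++ w); last exact: size_cat.
by split=> [a|]; rewrite ?big_cat // mem_cat => /orP[/vS|/wS].
Qed.

Lemma conj_lengthsJ g j n : conj_lengths g n -> conj_lengths (g ^ j) n.
Proof.
move=> [w [wS ->] <-]; exists [seq a ^ j | a <- w]; last exact: size_map.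
split=> [_ /mapP[a /wS aS ->]|]; first exact: signed_conjugatesJ.
by rewrite big_map (big_morph (conjg^~ j) (fun x y => conjMg x y j) (conj1g j)).
Qed.

Lemma conj_lengthsV g n : conj_lengths g n -> conj_lengths g^-1 n.
Proof.
move=> [w [wS ->] <-]; elim: w wS => [|a w IHw] wS.
  by rewrite big_nil invg1; apply: conj_lengths1.
rewrite big_cons invgM /= -addn1; apply: conj_lengthsM.
  by apply: IHw => b bw; apply: wS; rewrite inE bw orbT.
by apply/conj_lengths_gen/signed_conjugatesV/wS; rewrite inE eqxx.
Qed.

(** The elements that admit some factorization form a subgroup containing all conjugates of elements
    of [S], hence are all of [G]. *)
Lemma conj_lengths_neq0 : normally_generates S -> forall g, conj_lengths g !=set0.
Proof.
move=> genS.
pose P : {pred G} := fun g => `[< conj_lengths g !=set0 >].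
have P1 : 1 \in P by apply/asboolP; exists 0; apply: conj_lengths1.
have PM : {in P &, forall x y, x * y \in P}.
  move=> g h /asboolP[m gm] /asboolP[n hn]; apply/asboolP; exists (m + n)%N.
  exact: conj_lengthsM.
have PV : {in P, forall x, x^-1 \in P}.
  by move=> g /asboolP[n gn]; apply/asboolP; exists n; apply: conj_lengthsV.
pose PH := isMulClosed.Build G P PM.
pose P1H := isMul1Closed.Build G P P1.
pose PVH := isInvClosed.Build G P PV.
pose K : groupClosed G := HB.pack P PH P1H PVH.
move=> g; apply/asboolP; apply: (genS K) => a [t St [k _ <-]]; apply/asboolP.
by exists 1%N; apply: conj_lengths_gen; exists t; [left | exists k].
Qed.

End ConjWords.

Section RackWords.
Set Implicit Arguments.
Unset Strict Implicit.
Variables (G : groupType) (S : set G) (H : S -> groupClosed G).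
Hypothesis S_neq0 : S !=set0.
Hypothesis H_central : forall s : S, {in H s, forall h, commute h (val s)}.

Notation X := (coset_rack S_neq0 H_central).

Lemma psi_pm_shift e s x :
  @psi_pm X e (coset_rack_pt (lcoset (H s) x)) =1
  coset_shift ((if e then val s else (val s)^-1) ^ x^-1).
Proof.
move=> q; rewrite /conjg invgK mulgA.
have shiftE := coset_rack_op_shift H_central s x.
case: e; first exact: shiftE.
(* The inverse map is identified by applying the injective [psi] to both sides: each then becomes
   [q]. *)
apply: (can_inj (@psiK X (coset_rack_pt (lcoset (H s) x)))).
rewrite [LHS]psi_invK /psi /= shiftE -[RHS]/((_ \o _) q) -coset_shiftM.
by rewrite !mulgA mulgVK mulgK mulgV coset_shift1.
Qed.

Lemma psi_word_shift (w : seq (bool * X)) :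
  exists2 g, conj_lengths S g (size w) & psi_word w =1 coset_shift g.
Proof.
elim: w => [|[e p] w [g gS wE]].
  by exists 1; [apply: conj_lengths1 | move=> q; rewrite coset_shift1].
have [s [x ->]] := coset_rack_ptP p.
exists ((if e then val s else (val s)^-1) ^ x^-1 * g).
  rewrite /= -add1n; apply: conj_lengthsM gS; apply: conj_lengths_gen.
  exists (if e then val s else (val s)^-1); last by exists x^-1.
  have Ss : S (val s) by apply: set_mem; apply: valP.
  by case: e; [left | right; exists (val s)].
by move=> q; rewrite coset_shiftM /= wE psi_pm_shift.
Qed.

Lemma shift_psi_word g n : conj_lengths S g n ->
  exists2 w : seq (bool * X), size w = n & psi_word w =1 coset_shift g.
Proof.
move=> [v [vS ->] <-]; elim: v vS => [|a v IHv] vS.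
  by exists [::] => // q; rewrite big_nil coset_shift1.
have [|w sw wE] := IHv; first by move=> b bv; apply: vS; rewrite inE bv orbT.
have [e [p pE]] : exists e p, @psi_pm X e p =1 coset_shift a.
  have [|t tS [x _ <-]] := vS a; first by rewrite inE eqxx.
  have [e [s ->]] : exists e (s : S), t = if e then val s else (val s)^-1.
    case: tS => [St|[u Su <-]]; first by exists true, (exist _ t (mem_set St)).
    by exists false, (exist _ u (mem_set Su)).
  (* The coset of [y] acts through conjugation by [y^-1], so [y = x^-1] produces the factor
     [t ^ x]. *)
  exists e, (coset_rack_pt (lcoset (H s) x^-1)) => q.
  by rewrite psi_pm_shift invgK.
by exists ((e, p) :: w) => [|q]; rewrite /= ?sw // pE wE big_cons coset_shiftM.
Qed.

Lemma coset_rack_pt_inj (s : S) : injective (@coset_rack_pt G S H s).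
Proof. by move=> p q /eqP; rewrite eq_Tagged => /eqP. Qed.

(** Translation by [g] takes [xH] to [yH] exactly when [g ^ x = x^-1 * y * h] for some [h] in [H s],
    and conjugation by [x] preserves lengths. *)
Lemma rack_lengthsE s (x y : G) :
  [set size w | w in [set w : seq (bool * X) |
    coset_rack_pt (lcoset (H s) y) = psi_word w (coset_rack_pt (lcoset (H s) x))]]
  = \bigcup_(h in [set h | h \in H s]) conj_lengths S (x^-1 * y * h).
Proof.
apply/seteqP; split=> [_ [w /= yE <-]|n [h /= hH gn]].
  have [g gS wE] := psi_word_shift w.
  move: yE; rewrite wE coset_shiftE => /coset_rack_pt_inj/lcosetP gxy.
  exists (y^-1 * (g * x)) => //=.
  by rewrite mulgA mulgK; apply: (conj_lengthsJ x gS).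
(* Conjugating back by [x^-1] gives the translation by [y * h * x^-1], which sends [xH] to
   [yhH = yH]. *)
have [w <- wE] := shift_psi_word (conj_lengthsJ x^-1 gn).
exists w => //=; rewrite wE coset_shiftE; congr coset_rack_pt; apply/lcosetP.
by rewrite /conjg invgK !mulgA mulgVK mulgK mulVg mul1g.
Qed.

Lemma rack_dist_coset_rack s (p q : lcosets (H s)) : normally_generates S ->
  rack_dist X (coset_rack_pt p) (coset_rack_pt q) = quot_dist S p q.
Proof.
move=> genS; rewrite -(lcoset_repr p) -(lcoset_repr q) quot_dist_lcoset.
rewrite /rack_dist rack_lengthsE -nat_min_bigcup //.
  by exists 1; apply: gpred1.
by move=> h _; apply: conj_lengths_neq0.
Qed.

End RackWords.

Local Open Scope ring_scope.

Theorem theorem3p1 (R : realType) (G : groupType) (S : set G)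
    (H : S -> groupClosed G)
    (S_neq0 : S !=set0)
    (H_central : forall s : S, {in H s, forall h, commute h (val s)})
    (genS : normally_generates S)
    (s : S)
    (Xs_component : connected_component (coset_part S_neq0 H_central s)) :
  exists C : R, 1 <= C /\
    forall p q : lcosets (H s),
      let dS := (quot_dist S p q)%:R : R in
      let ds := (rack_dist (coset_rack S_neq0 H_central)
                   (coset_rack_pt p) (coset_rack_pt q))%:R : R in
      C^-1 * dS <= ds /\ ds <= C * dS.
Proof.
(* The two distances are equal, so the constant 1 works. *)
exists 1; split=> [|p q]; first exact: Order.POrderTheory.lexx.
by rewrite /= rack_dist_coset_rack // GRing.invr1 GRing.mul1r.
Qed.
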